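(* Let $T$ and $T'$ be finite trees. Suppose that $$\mu_T(w)=\mu_{T'}(w)\qquad\text{for every } w\in\mathbb R\langle x,y\rangle,$$ where $\mu_G(w)=\mathbf 1^T w(A_G,D_G)\mathbf 1$. Then $T\cong T'$.
   Context: $\mathbb R\langle x,y\rangle$ is the free associative unital real algebra of noncommutative polynomials in $x,y$. For a finite simple graph $G$, $A_G$ is the adjacency matrix, $D_G$ the diagonal degree matrix, $\mathbf 1$ the all-ones vector in $\mathbb R^{V(G)}$, and $w(A_G,D_G)$ is the matrix obtained by substituting $x=A_G$, $y=D_G$ (the empty word evaluates to the identity matrix). *)

(* Defs.v *)
From HB Require Import structures.
From mathcomp Require Import all_boot all_order all_algebra.
From mathcomp Require Import finmap reals.
From mathcomp Require Import monalg.

Set Implicit Arguments.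
Unset Strict Implicit.
Unset Printing Implicit Defensive.

Import GRing.Theory.
Local Open Scope ring_scope.

Record sgraph := SGraph {
  vertex :> finType;
  adj : rel vertex;
  adj_sym : symmetric adj;
  adj_irr : irreflexive adj
}.

Definition connected_graph (G : sgraph) : Prop :=
  (0 < #|G|)%N /\ forall u v : G, connect (@adj G) u v.

(* For an irreflexive symmetric relation a [ucycle] of length 2 is a single
   edge walked back and forth, so the cycles of a simple graph are exactly
   the [ucycle]s of length at least 3. *)
Definition acyclic_graph (G : sgraph) : Prop :=
  forall c : seq G, (2 < size c)%N -> ~~ ucycleb (@adj G) c.

Definition is_tree (G : sgraph) : Prop :=
  connected_graph G /\ acyclic_graph G.

Definition graph_iso (G H : sgraph) : Prop :=
  exists2 f : G -> H, bijective f & forall u v, adj (f u) (f v) = adj u v.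

(* The monoid algebra of the free monoid on two letters; the letter x is
   [false] and the letter y is [true]. *)
Definition ncpoly (R : nzRingType) := {malg R[{fmonom bool}]}.

Definition ncX (R : nzRingType) : ncpoly R := << fmu false >>.
Definition ncY (R : nzRingType) : ncpoly R := << fmu true >>.

Section Evaluation.
Variables (R : comNzRingType) (n : nat).
Implicit Types (A D : 'M[R]_n) (w : ncpoly R).

Definition word_eval A D (m : {fmonom bool}) : 'M[R]_n :=
  \prod_(l <- (m : seq bool)) (if l then D else A).

(* [mmap] is not available here: it requires a nontrivial target ring, which
   ['M[R]_n] is not for [n = 0]. *)
Definition nc_eval A D w : 'M[R]_n :=
  \sum_(m <- msupp w) w@_m *: word_eval A D m.

Lemma nc_evalEw A D w (d : {fset {fmonom bool}}) : (msupp w `<=` d)%fset ->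
  nc_eval A D w = \sum_(m <- d) w@_m *: word_eval A D m.
Proof.
move=> le; rewrite /nc_eval (big_fset_incl _ le) // => m _ /mcoeff_outdom ->.
by rewrite scale0r.
Qed.

Lemma nc_evalU A D c m : nc_eval A D << c *g m >> = c *: word_eval A D m.
Proof. by rewrite (nc_evalEw _ _ msuppU_le) big_seq_fset1 mcoeffUU. Qed.

Lemma nc_evalX A D : nc_eval A D (ncX R) = A.
Proof. by rewrite nc_evalU scale1r /word_eval /fmu fmE big_seq1. Qed.

Lemma nc_evalY A D : nc_eval A D (ncY R) = D.
Proof. by rewrite nc_evalU scale1r /word_eval /fmu fmE big_seq1. Qed.

Lemma nc_eval1 A D : nc_eval A D 1 = 1%:M.
Proof. by rewrite nc_evalU scale1r /word_eval fm1 big_nil. Qed.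

Lemma nc_evalD A D w1 w2 :
  nc_eval A D (w1 + w2) = nc_eval A D w1 + nc_eval A D w2.
Proof.
have le1 := fsubsetUl (msupp w1) (msupp w2).
have le2 := fsubsetUr (msupp w1) (msupp w2).
rewrite (nc_evalEw _ _ le1) (nc_evalEw _ _ le2) (nc_evalEw _ _ (msuppD_le _ _)).
by rewrite -big_split; apply: eq_bigr => m _; rewrite mcoeffD scalerDl.
Qed.

Lemma nc_evalZ A D c w : nc_eval A D (c *: w) = c *: nc_eval A D w.
Proof.
rewrite (nc_evalEw _ _ (msuppZ_le _ _)) /nc_eval scaler_sumr.
by apply: eq_bigr => m _; rewrite mcoeffZ scalerA.
Qed.

Lemma word_evalM A D (m1 m2 : {fmonom bool}) :
  word_eval A D (mmul m1 m2) = word_eval A D m1 *m word_eval A D m2.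
Proof. by rewrite /word_eval fmM big_cat. Qed.

Lemma nc_eval_sum A D (I : Type) (r : seq I) (F : I -> ncpoly R) :
  nc_eval A D (\sum_(i <- r) F i) = \sum_(i <- r) nc_eval A D (F i).
Proof.
elim: r => [|i r IH]; last by rewrite !big_cons nc_evalD IH.
by rewrite !big_nil /nc_eval msupp0 big_seq_fset0.
Qed.

Lemma nc_evalM A D w1 w2 :
  nc_eval A D (w1 * w2) = nc_eval A D w1 *m nc_eval A D w2.
Proof.
rewrite malgM_def /fgmul nc_eval_sum [in RHS]/nc_eval mulmx_suml.
apply: eq_bigr => m1 _; rewrite nc_eval_sum mulmx_sumr.
apply: eq_bigr => m2 _.
by rewrite nc_evalU word_evalM -scalemxAl -scalemxAr scalerA.
Qed.

End Evaluation.

Section Moments.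
Variables (R : comNzRingType) (G : sgraph).

(* Rows and columns are indexed by the vertices through [enum_val]. *)
Definition adjmx : 'M[R]_#|G| :=
  \matrix_(i, j) (adj (enum_val i) (enum_val j))%:R.

Definition degmx : 'M[R]_#|G| :=
  diag_mx (\row_i #|[set v | adj (enum_val i) v]|%:R).

Definition ones : 'cV[R]_#|G| := const_mx 1.

Definition moment (w : ncpoly R) : R :=
  (ones^T *m nc_eval adjmx degmx w *m ones) 0 0.

End Moments.

(* Main.v *)
Require Import Defs.
From mathcomp Require Import all_boot all_order all_algebra.
From mathcomp Require Import reals.
From mathcomp Require Import boolp monalg zify.

(** The proof recovers a tree by stripping its leaves layer by layer, and shows
    that the polynomials in the adjacency matrix A and the degree matrix D can
    follow this process.

    Both trees are placed side by side in the forest F = T + T', and a function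
    f on F is called definable when one and the same polynomial w evaluates to
    the diagonal matrix diag(f) on each tree.  Definable functions form an
    algebra, so by Lagrange interpolation the level sets of a definable function
    have definable indicators.  Two vertices get the same colour when no
    definable set separates them; a set is definable if and only if it is a
    union of colour classes ([invariant_definable], [color_definable]).

    Three facts link colours to the trees.  The degree is definable
    ([color_deg]).  The moment of the polynomial of diag(1_K) is the number of
    vertices of a colour class K in the tree, so equality of moments says that
    the two trees have equally many vertices of each colour ([color_side]).
    Finally, suppose that S and L are definable and that every vertex of L has
    at most one neighbour in S.  Then two distinct vertices of S have no common
    neighbour in L, so 1_S A 1_L A 1_S is diagonal, with entry at u in S the
    number of neighbours of u in L; this number thus depends only on the colour
    of u ([color_nbrs]).

    Now let core 0 = F and let core (i+1) be core i without its vertices of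
    degree at most 1 in core i.  With S = core i, and L first the whole layer
    that is removed and then a colour class inside it, the third fact shows that
    each core is definable and that vertices of the same colour have, for each
    colour k, equally many lower neighbours of colour k ([card_children]), where
    the rank of a vertex is the last i with the vertex in core i.  A vertex has
    at most one neighbour of rank at least its own.  If that neighbour is of
    larger rank it is the parent; the vertices without parent are the one or two
    central vertices of each tree ([roots_adj]).

    An isomorphism is then built from the centre outwards: roots of T go to
    roots of T' of the same colour, and the children of p go to the children of
    the image of p, again by a bijection that keeps the colour ([matching]). *)

Set Implicit Arguments.
Unset Strict Implicit.
Unset Printing Implicit Defensive.

(** * Leaves of finite acyclic graphs *)

Section Leaf.
Variable G : sgraph.

Definition nbrs (u : G) : {set G} := [set v | adj u v].

Lemma in_nbrs u v : (v \in nbrs u) = adj u v.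
Proof. by rewrite inE. Qed.

(** If all degrees inside [S] were at least 2, a simple path in [S] could be
    prolonged for ever: its first vertex has a neighbour in [S] other than its
    successor, which is not on the path since that would close a cycle. *)
Lemma acyclic_leaf (S : {set G}) : acyclic_graph G -> S != set0 ->
  exists2 v, v \in S & #|nbrs v :&: S| <= 1.
Proof.
move=> acG /set0Pn[x0 x0S]; apply/exists_inP; apply: contraT => /exists_inPn deg2.
suff longp n : exists x p,
    [/\ path (@adj G) x p, uniq (x :: p), all (mem S) (x :: p) & size p = n].
  have [x [p [_ Up _ sz_p]]] := longp #|G|.
  by have := max_card (mem (x :: p)); rewrite (card_uniqP Up) /= sz_p ltnn.
elim: n => [|n [x [p [px Up Sp sz_p]]]]; first by exists x0, [::]; rewrite /= x0S.
have xS : x \in S by case/andP: Sp.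
have /deg2 := xS; rewrite -ltnNge => /card_gt1P[z1 [z2 [z1N z2N z12]]].
(* for an empty [p] the default value of [head] excludes only [x] itself *)
have [z [zx zS zp]] : exists z, [/\ adj x z, z \in S & z != head x p].
  move: z1N z2N; rewrite !inE => /andP[xz1 z1S] /andP[xz2 z2S].
  by have [z1p|?] := eqVneq z1 (head x p); [exists z2; rewrite -z1p eq_sym | exists z1].
have zx' : adj z x by rewrite adj_sym.
have [z_xp|z_xp] := boolP (z \in x :: p); last first.
  by exists z, (x :: p); split; rewrite /= ?zx' ?sz_p // ?z_xp // zS.
move: z_xp; rewrite inE => /orP[/eqP zEx|z_p]; first by rewrite zEx adj_irr in zx.
case/splitPr: z_p => p1 p2 in px Up Sp sz_p zp *.
case: p1 => [|y p1] in px Up Sp sz_p zp *; first by rewrite eqxx in zp.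
have /negP[] : ~~ ucycleb (@adj G) (x :: rcons (y :: p1) z).
  by apply: acG; rewrite /= size_rcons.
apply/andP; split.
  move: px; rewrite /= !rcons_path last_rcons zx' andbT cat_path /=.
  by case/and4P=> -> -> -> _.
by move: Up; rewrite -cat_rcons -cat_cons cat_uniq => /andP[].
Qed.

End Leaf.

(** * Colour-preserving injections *)

Section Transport.
Variables (V : finType) (C : eqType) (c : V -> C).

(** The [i]-th element of [X] of a given colour goes to the [i]-th element of
    [Y] of that colour; the first argument [x] of [nth] is a default value, out
    of reach when [X] and [Y] have equally many elements of each colour. *)
Definition transport (X Y : {set V}) (x : V) : V :=
  nth x (enum [set y in Y | c y == c x]) (index x (enum [set y in X | c y == c x])).

Variables X Y : {set V}.
Hypothesis cardXY : forall k,
  #|[set x in X | c x == k]| = #|[set y in Y | c y == k]|.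

Lemma transportP x : x \in X -> transport X Y x \in Y /\ c (transport X Y x) = c x.
Proof.
move=> xX; suff: transport X Y x \in enum [set y in Y | c y == c x].
  by rewrite mem_enum inE => /andP[? /eqP].
by rewrite mem_nth // -cardE -cardXY cardE index_mem mem_enum inE xX eqxx.
Qed.

Lemma transport_inj : {in X &, injective (transport X Y)}.
Proof.
move=> x y xX yX fxy.
have cxy : c x = c y by rewrite -(transportP xX).2 fxy (transportP yX).2.
have szX z : z \in X -> c z = c x ->
    index z (enum [set y in X | c y == c x]) < size (enum [set y in Y | c y == c x]).
  by move=> zX czx; rewrite -cardE -cardXY cardE index_mem mem_enum inE zX czx eqxx.
move: fxy; rewrite /transport -cxy (set_nth_default x y) ?szX //.
move/eqP; rewrite nth_uniq ?enum_uniq ?szX //.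
move=> /eqP /(congr1 (nth x (enum [set y in X | c y == c x]))).
by rewrite !nth_index // mem_enum inE ?xX ?yX ?cxy eqxx.
Qed.

End Transport.

(** * Stripping the leaves of a coloured forest *)

Section Strip.
Variables (F : sgraph) (side : pred F) (C : eqType) (c : F -> C).

Definition invariant_set (S : {set F}) :=
  forall u v, c u = c v -> (u \in S) = (v \in S).

(* The forest [F] consists of two trees, told apart by [side]. *)
Hypothesis acF : acyclic_graph F.
Hypothesis side_adj : forall u v : F, adj u v -> side u = side v.
Hypothesis side_connect : forall u v : F, side u = side v -> connect (@adj F) u v.
(* The links between colours and trees that the moments will provide; [c_nbrs]
   is where the tree structure enters, since its condition on [L] holds for the
   leaves of the subforest induced by [S]. *)
Hypothesis c_deg : forall u v, c u = c v -> #|nbrs u| = #|nbrs v|.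
Hypothesis c_nbrs : forall S L : {set F}, invariant_set S -> invariant_set L ->
  (forall x, x \in L -> #|nbrs x :&: S| <= 1) ->
  forall u v, u \in S -> v \in S -> c u = c v ->
  #|nbrs u :&: L| = #|nbrs v :&: L|.
Hypothesis c_side : forall k,
  #|[set x in [set x | side x] | c x == k]| =
  #|[set x in [set x | ~~ side x] | c x == k]|.

Fixpoint core i : {set F} :=
  if i is j.+1 then [set v in core j | 1 < #|nbrs v :&: core j|] else setT.

Lemma coreS i v : (v \in core i.+1) = (v \in core i) && (1 < #|nbrs v :&: core i|).
Proof. by rewrite inE. Qed.

Lemma core_sub i j : i <= j -> core j \subset core i.
Proof.
move/subnK<-; elim: (j - i) => //= n IHn.
by apply: subset_trans IHn; apply/subsetP=> v; rewrite inE => /andP[].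
Qed.

Lemma core_card i : #|core i| <= #|F| - i.
Proof.
elim: i => [|i IHi]; first by rewrite cardsT subn0.
have [core0|/(acyclic_leaf acF)[v vi v1]] := eqVneq (core i) set0.
  by rewrite (leq_trans (subset_leq_card (core_sub (leqnSn i)))) // core0 cards0.
have: core i.+1 \proper core i.
  apply/properP; split; first exact: core_sub.
  by exists v => //; rewrite coreS vi -leqNgt.
by move/proper_card; move: IHi; lia.
Qed.

Lemma core_dies v : exists i, v \notin core i.+1.
Proof.
exists #|F|; apply/negP=> vF; have := core_card #|F|.+1.
by have: 0 < #|core #|F|.+1| by [apply/card_gt0P; exists v]; lia.
Qed.

Definition rank v := ex_minn (core_dies v).

Lemma in_core i v : (v \in core i) = (i <= rank v).
Proof.
rewrite /rank; case: ex_minnP => r vr r_min.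
have [le_ir|lt_ri] := leqP i r; last first.
  by apply: contraNF vr => /(subsetP (core_sub lt_ri)).
case: i le_ir => [|i lt_ir]; first by rewrite inE.
by apply: contraLR (lt_ir) => /r_min; rewrite -leqNgt.
Qed.

(** [u] is not in [core (rank u).+1], so it has at most one neighbour in
    [core (rank u)], and this core consists of the vertices of rank at least
    [rank u]. *)
Lemma upper_nbr u v w :
  adj u v -> adj u w -> rank u <= rank v -> rank u <= rank w -> v = w.
Proof.
move=> uv uw r_uv r_uw.
have: u \notin core (rank u).+1 by rewrite in_core ltnn.
rewrite coreS in_core leqnn -leqNgt /= => /card_le1P le1.
have v_up : v \in nbrs u :&: core (rank u) by rewrite inE in_nbrs in_core uv.
by apply/esym/eqP; rewrite -[_ == _](le1 v v_up w) inE in_nbrs in_core uw.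
Qed.

Definition same_nbrs_in (S X : {set F}) :=
  forall u v, u \in X -> v \in X -> c u = c v -> #|nbrs u :&: S| = #|nbrs v :&: S|.

(** The removed layer [L] meets the hypothesis of [c_nbrs] for [S = core i], so
    the neighbours in [L] are counted by the colour; subtracting them from the
    neighbours in [core i] leaves those in the next core. *)
Lemma core_step i : invariant_set (core i) -> same_nbrs_in (core i) (core i) ->
  invariant_set (core i.+1) /\ same_nbrs_in (core i.+1) (core i).
Proof.
move=> inv_i deg_i.
have inv_i1 : invariant_set (core i.+1).
  move=> u v cuv; rewrite !coreS -(inv_i _ _ cuv); case: (boolP (u \in _)) => //= ui.
  by rewrite (deg_i u v) // -(inv_i _ _ cuv).
split=> // u v ui vi cuv; pose L := core i :\: core i.+1.
have splitL w : #|nbrs w :&: core i| = #|nbrs w :&: core i.+1| + #|nbrs w :&: L|.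
  rewrite -(cardsID (core i.+1)) setIDA; congr (_ + _).
  by rewrite -setIA (setIidPr (core_sub (leqnSn i))).
have eqL : #|nbrs u :&: L| = #|nbrs v :&: L|.
  apply: (c_nbrs inv_i) ui vi cuv.
    by move=> x y cxy; rewrite !in_setD (inv_i _ _ cxy) (inv_i1 _ _ cxy).
  by move=> x; rewrite in_setD coreS => /andP[+ xi]; rewrite xi -leqNgt.
by have /eqP := deg_i u v ui vi cuv; rewrite !splitL eqL eqn_add2r => /eqP.
Qed.

Lemma core_inv i : invariant_set (core i) /\ same_nbrs_in (core i) (core i).
Proof.
elim: i => [|i [inv_i deg_i]].
  by split=> [u v _|u v _ _ /c_deg]; rewrite ?inE // !setIT.
have [inv_i1 deg_i1] := core_step inv_i deg_i; split=> // u v.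
by rewrite !coreS => /andP[ui _] /andP[vi _]; apply: deg_i1.
Qed.

Lemma rank_color u v : c u = c v -> rank u = rank v.
Proof.
move=> cuv; have inv i := (core_inv i).1 u v cuv.
by apply/eqP; rewrite eqn_leq -!in_core -inv in_core leqnn inv in_core leqnn.
Qed.

(** A root is the last vertex left in its tree, or one end of the last edge
    left: a neighbour of equal rank is allowed. *)
Definition root u := [forall v, adj u v ==> (rank v <= rank u)].

Lemma rootE u : root u = (#|nbrs u :&: core (rank u).+1| == 0).
Proof.
rewrite cards_eq0; apply/forallP/eqP=> [root_u|no v].
  apply/setP=> v; rewrite in_set0 in_setI in_nbrs in_core; apply/negP=> /andP[uv lt_uv].
  by have := root_u v; rewrite uv leqNgt lt_uv.
apply/implyP=> uv; rewrite leqNgt; apply/negP=> lt_uv.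
by have := in_set0 v; rewrite -no in_setI in_nbrs uv in_core lt_uv.
Qed.

Lemma root_color u v : c u = c v -> root u = root v.
Proof.
move=> cuv; have r_uv := rank_color cuv; have [inv_r deg_r] := core_inv (rank u).
rewrite !rootE -r_uv; congr (_ == _).
by apply: (core_step inv_r deg_r).2; rewrite // in_core // r_uv.
Qed.

Definition parent u := [pick v | adj u v && (rank u < rank v)].

Lemma parentP u p : parent u = Some p <-> adj u p /\ rank u < rank p.
Proof.
split; rewrite /parent; case: pickP => [v /andP[uv r_uv]|no] //.
- by case=> <-.
- by case=> up r_up; rewrite (upper_nbr uv up) // ltnW.
- by case=> up r_up; have := no p; rewrite up r_up.
Qed.

Lemma parent_root u : parent u = None <-> root u.
Proof.
split=> [|/forallP root_u].
  rewrite /parent; case: pickP => // no _; apply/forallP=> v; apply/implyP=> uv.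
  by have := no v; rewrite uv /= ltnNge => /negbFE.
case pu: (parent u) => [p|//]; have [up] := (parentP u p).1 pu.
by have /implyP/(_ up) := root_u p; rewrite leqNgt => /negbTE->.
Qed.

(** By [upper_nbr], a vertex inside a simple path has a neighbour of smaller rank
    on the path.  Hence, once the rank does not increase, it decreases strictly
    until the end of the path, which cannot then be a root. *)
Lemma root_path u v p : path (@adj F) u (v :: p) -> uniq [:: u, v & p] ->
  rank v <= rank u -> root (last v p) -> p = [::].
Proof.
elim: p u v => // w p IHp u v /= /and3P[uv vw pw] /andP[+ Uw] r_vu root_l.
rewrite !inE !negb_or => /and3P[_ uw _].
have r_wv : rank w < rank v.
  rewrite ltnNge; apply/negP=> r_vw; case/eqP: uw.
  by apply: (@upper_nbr v); rewrite // adj_sym.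
have p0 : p = [::] by apply: (IHp v w) => //=; rewrite ?vw // ltnW.
move: root_l; rewrite p0 => /forallP/(_ v); rewrite adj_sym vw /=.
by rewrite leqNgt r_wv.
Qed.

Lemma roots_adj u v : side u = side v -> root u -> root v -> u != v -> adj u v.
Proof.
move=> /side_connect/connectP[p0 pu ->] root_u; case/shortenP: pu => p.
case: p => [|w p] pu Up _ root_v; first by rewrite eqxx.
case/andP: (pu) => uw _; have /implyP/(_ uw) r_wu := forallP root_u w.
by rewrite (root_path pu Up r_wu root_v).
Qed.

Definition children p : {set F} := [set x | adj p x && (rank x < rank p)].

Lemma in_children p x : (x \in children p) = (parent x == Some p).
Proof.
rewrite inE adj_sym; apply/andP/eqP; last by move/parentP.
by move=> ?; apply/parentP.
Qed.

(** All vertices of colour [k] have the same rank [r].  If [r < rank p], the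
    children of [p] of colour [k] are its neighbours of that colour, and these
    are counted by [c_nbrs] with [S = core r] and the colour class for [L];
    otherwise there are none. *)
Lemma card_children p q k : c p = c q ->
  #|[set x in children p | c x == k]| = #|[set x in children q | c x == k]|.
Proof.
move=> cpq; have r_pq := rank_color cpq.
have [/existsP[x0 /eqP cx0]|no_k] := boolP [exists x, c x == k]; last first.
  have empty s : [set x in children s | c x == k] = set0.
    by apply/setP=> x; rewrite !inE (negbTE (existsPn no_k x)) andbF.
  by rewrite !empty.
pose K := [set x | c x == k].
have rK x : x \in K -> rank x = rank x0.
  by rewrite inE => /eqP cx; apply: rank_color; rewrite cx.
have [lt_0p|le_p0] := ltnP (rank x0) (rank p); last first.
  have empty s : rank s = rank p -> [set x in children s | c x == k] = set0.
    move=> r_s; apply/setP=> x; rewrite !inE; apply/negP=> /andP[/andP[_ lt_xs] cx].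
    by move: lt_xs; rewrite (rK x) ?inE // r_s ltnNge le_p0.
  by rewrite !empty.
have childK s : rank s = rank p -> [set x in children s | c x == k] = nbrs s :&: K.
  move=> r_s; apply/setP=> x; rewrite !inE.
  case: (boolP (c x == k)) => cx; last by rewrite !andbF.
  by rewrite (rK x) ?inE // r_s lt_0p !andbT.
rewrite !childK //; apply: (c_nbrs (core_inv (rank x0)).1 _ _ _ _ cpq).
- by move=> x y cxy; rewrite !inE cxy.
- move=> x xK; rewrite leqNgt; apply/negP=> gt1.
  have: x \in core (rank x0).+1 by rewrite coreS gt1 in_core (rK x xK) leqnn.
  by rewrite in_core (rK x xK) ltnn.
- by rewrite in_core ltnW.
- by rewrite in_core -r_pq ltnW.
Qed.

(** One step of the construction from the centre outwards: the image of [x] is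
    read off the image [f p] of its parent.  The wanted map is the fixed point of
    [extend], reached after [#|F|] steps since all ranks are smaller. *)
Definition extend (f : F -> F) (x : F) : F :=
  if parent x is Some p then transport c (children p) (children (f p)) x
  else transport c [set y | side y] [set y | ~~ side y] x.

Definition matching : F -> F := iter #|F| extend id.

Lemma rank_lt v : rank v < #|F|.
Proof.
have: 0 < #|core (rank v)| by apply/card_gt0P; exists v; rewrite in_core.
by have := core_card (rank v); lia.
Qed.

Lemma matchingE x : matching x = extend matching x.
Proof.
rewrite /matching -iterS; have := leq_addl (rank x) #|F|.
(* the value at [x] is stable after [n] steps as soon as [#|F| <= rank x + n] *)
move: {2 3 4}#|F| => n; elim: n x => [|n IHn] x.
  by rewrite addn0 leqNgt rank_lt.
rewrite !iterS [LHS]/extend [RHS]/extend; case px: (parent x) => [p|//] le_n.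
rewrite IHn //; have [_] := (parentP x p).1 px; lia.
Qed.

(** Induction from the roots downwards. *)
Lemma rank_ind (P : F -> Prop) :
  (forall x, (forall p, parent x = Some p -> P p) -> P x) -> forall x, P x.
Proof.
move=> IH x; have [n] := ubnP (#|F| - rank x); elim: n x => // n IHn x le_n.
apply: IH => p /parentP[_ lt_xp]; apply: IHn.
by have := rank_lt p; lia.
Qed.

Lemma matchingP x : side x ->
  [/\ c (matching x) = c x, ~~ side (matching x) &
      forall p, parent x = Some p -> parent (matching x) = Some (matching p)].
Proof.
elim/rank_ind: x => x IHx sx; rewrite matchingE /extend.
case px: (parent x) => [p|].
  have [adj_xp _] := (parentP x p).1 px.
  have [cp sp _] := IHx p px (etrans (esym (side_adj adj_xp)) sx).
  have [|] := transportP (fun k => card_children k (esym cp)) (_ : x \in children p).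
    by rewrite in_children px.
  rewrite in_children => /eqP py cy; split=> // [|q [<-] //].
  by have [/side_adj-> _] := (parentP _ _).1 py.
by have [|] := transportP c_side (_ : x \in _); rewrite inE.
Qed.

(** The image of a non-root has at most one parent, so [f x = f y] forces the
    parents of [x] and [y] to have the same image; by induction these parents
    are equal, and [transport] is injective on their children. *)
Lemma matching_inj : {in side &, injective matching}.
Proof.
move=> x; elim/rank_ind: x => x IHx y sx sy fxy.
have [cx _ fpx] := matchingP sx; have [cy _ fpy] := matchingP sy.
have cxy : c x = c y by rewrite -cx fxy.
case px: (parent x) => [p|]; case py: (parent y) => [q|].
- have [adj_xp _] := (parentP x p).1 px; have [adj_yq _] := (parentP y q).1 py.
  have sp : side p by rewrite -(side_adj adj_xp).
  have sq : side q by rewrite -(side_adj adj_yq).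
  have pq : p = q.
    by apply: (IHx p px) => //; apply: Some_inj; rewrite -(fpx p px) -(fpy q py) fxy.
  have [cp _ _] := matchingP sp; move: fxy; rewrite (matchingE x) (matchingE y).
  rewrite /extend px py -pq; apply: transport_inj.
  + by move=> k; apply: card_children.
  + by rewrite in_children px.
  + by rewrite in_children py pq.
- by move/parent_root: py; rewrite -(root_color cxy) => /parent_root; rewrite px.
- by move/parent_root: px; rewrite (root_color cxy) => /parent_root; rewrite py.
- move: fxy; rewrite (matchingE x) (matchingE y) /extend px py.
  by apply: (transport_inj c_side); rewrite inE.
Qed.

Lemma adj_roots u v : adj u v -> rank u = rank v -> root u.
Proof.
move=> uv r_uv; apply/forallP=> w; apply/implyP=> uw; rewrite leqNgt.
apply/negP=> lt_uw; have vw : v = w.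
  by apply: upper_nbr uv uw _ (ltnW lt_uw); rewrite r_uv.
by rewrite -vw r_uv ltnn in lt_uw.
Qed.

(** An edge between different ranks joins a vertex to its parent, and [matching]
    commutes with [parent].  An edge between equal ranks joins the two roots of
    a tree, and distinct roots of a tree are adjacent. *)
Lemma matching_adj : {in side &, {mono matching : u v / adj u v}}.
Proof.
move=> u v su sv.
have [cu su' fpu] := matchingP su; have [cv sv' fpv] := matchingP sv.
have ru := rank_color cu; have rv := rank_color cv.
have lt_case x y : side x -> side y -> rank x < rank y ->
    adj (matching x) (matching y) = adj x y.
  move=> sx sy lt_xy; have [cx sx' fpx] := matchingP sx; have [cy _ _] := matchingP sy.
  have lt_fxy : rank (matching x) < rank (matching y).
    by rewrite (rank_color cx) (rank_color cy).
  apply/idP/idP=> [fxy|xy]; last first.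
    have px : parent x = Some y by apply/parentP.
    by have [] := (parentP _ _).1 (fpx y px).
  have pfx : parent (matching x) = Some (matching y) by apply/parentP.
  case px: (parent x) => [p|]; last first.
    by move/parent_root: px; rewrite -(root_color cx) => /parent_root; rewrite pfx.
  have [xp _] := (parentP x p).1 px.
  have [eq_py] : Some (matching p) = Some (matching y) by rewrite -pfx (fpx p).
  by rewrite -(matching_inj _ _ eq_py) // unfold_in -(side_adj xp).
have [lt_uv|lt_vu|r_uv] := ltngtP (rank u) (rank v); first exact: lt_case.
  by rewrite adj_sym [RHS]adj_sym; apply: lt_case.
apply/idP/idP=> [fuv|uv].
  have r_fuv : rank (matching u) = rank (matching v) by rewrite ru rv.
  apply: roots_adj.
  - by move: su sv; rewrite !unfold_in => -> ->.
  - by rewrite -(root_color cu) (adj_roots fuv r_fuv).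
  - by rewrite -(root_color cv) (adj_roots _ (esym r_fuv)) // adj_sym.
  - by apply: contraTneq fuv => ->; rewrite adj_irr.
apply: roots_adj.
- by rewrite (negbTE su') (negbTE sv').
- by rewrite (root_color cu) (adj_roots uv r_uv).
- by rewrite (root_color cv) (adj_roots _ (esym r_uv)) // adj_sym.
- by apply: contraTneq uv => /matching_inj->; rewrite ?adj_irr.
Qed.

Lemma coloured_forest_matching : exists f : F -> F,
  [/\ {in side, forall x, ~~ side (f x)}, {in side &, injective f} &
      {in side &, {mono f : u v / adj u v}}].
Proof.
exists matching; split; [|exact: matching_inj|exact: matching_adj].
by move=> x /matchingP[].
Qed.

End Strip.

Import GRing.Theory Num.Theory.
Local Open Scope ring_scope.

(** * Evaluated polynomials as kernels on the vertices *)

Section Kernel.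
Variables (R : comNzRingType) (G : sgraph).
Implicit Types w : ncpoly R.

Definition kernel w (u v : G) : R :=
  nc_eval (adjmx R G) (degmx R G) w (enum_rank u) (enum_rank v).

Lemma kernel1 u v : kernel 1 u v = (u == v)%:R.
Proof. by rewrite /kernel nc_eval1 mxE (inj_eq enum_rank_inj). Qed.

Lemma kernelX u v : kernel (ncX R) u v = (adj u v)%:R.
Proof. by rewrite /kernel nc_evalX mxE !enum_rankK. Qed.

Lemma kernelY u v : kernel (ncY R) u v = #|nbrs u|%:R *+ (u == v).
Proof. by rewrite /kernel nc_evalY !mxE enum_rankK (inj_eq enum_rank_inj). Qed.

Lemma kernelD w1 w2 u v : kernel (w1 + w2) u v = kernel w1 u v + kernel w2 u v.
Proof. by rewrite /kernel nc_evalD mxE. Qed.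

Lemma kernelZ a w u v : kernel (a *: w) u v = a * kernel w u v.
Proof. by rewrite /kernel nc_evalZ mxE. Qed.

Lemma kernelM w1 w2 u v :
  kernel (w1 * w2) u v = \sum_x kernel w1 u x * kernel w2 x v.
Proof.
rewrite /kernel nc_evalM mxE (reindex enum_rank) //.
by exists enum_val => x _; rewrite ?enum_rankK ?enum_valK.
Qed.

Lemma moment_kernel w : moment G w = \sum_u \sum_v kernel w u v.
Proof.
have reindexG (f : 'I_#|G| -> R) : \sum_i f i = \sum_u f (enum_rank u).
  rewrite (reindex enum_rank) //.
  by exists enum_val => x _; rewrite ?enum_rankK ?enum_valK.
rewrite /moment mxE reindexG exchange_big; apply: eq_bigr => v _.
rewrite !mxE mulr1 reindexG; apply: eq_bigr => u _.
by rewrite !mxE mul1r.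
Qed.

Lemma moment1 : moment G (1 : ncpoly R) = #|G|%:R.
Proof.
rewrite moment_kernel -sumr_const; apply: eq_bigr => u _.
rewrite (bigD1 u) //= big1 => [|v vu]; first by rewrite kernel1 eqxx addr0.
by rewrite kernel1 eq_sym (negbTE vu).
Qed.

End Kernel.

(** * The disjoint union of two graphs *)

Section Union.
Variables T T' : sgraph.

Definition union_adj (u v : T + T') : bool :=
  match u, v with
  | inl x, inl y => adj x y
  | inr x, inr y => adj x y
  | _, _ => false
  end.

Lemma union_adj_sym : symmetric union_adj.
Proof. by case=> [x|x] [y|y] //=; rewrite adj_sym. Qed.

Lemma union_adj_irr : irreflexive union_adj.
Proof. by case=> x /=; rewrite adj_irr. Qed.

Definition union : sgraph := SGraph union_adj_sym union_adj_irr.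

Definition in_left (u : union) : bool := if u is inl _ then true else false.

Lemma union_adj_side (u v : union) : adj u v -> in_left u = in_left v.
Proof. by case: u v => [x|x] []. Qed.

Lemma union_pathl x p : path (@adj union) (inl x) p ->
  exists2 q, p = map inl q & path (@adj T) x q.
Proof.
elim: p x => [|[y|//] p IHp] x /=; first by exists [::].
by case/andP=> xy /IHp[q -> pq]; exists (y :: q) => //=; rewrite xy.
Qed.

Lemma union_pathr x p : path (@adj union) (inr x) p ->
  exists2 q, p = map inr q & path (@adj T') x q.
Proof.
elim: p x => [|[//|y] p IHp] x /=; first by exists [::].
by case/andP=> xy /IHp[q -> pq]; exists (y :: q) => //=; rewrite xy.
Qed.

Lemma union_acyclic : acyclic_graph T -> acyclic_graph T' -> acyclic_graph union.
Proof.
move=> acT acT' [//|[x|x] p] sz; apply/negP=> /andP[+ Up];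
  rewrite /= rcons_path.
- case/andP=> /union_pathl[q pq xq]; rewrite {p}pq in sz Up *.
  rewrite last_map /= => qx; rewrite -map_cons map_inj_uniq in Up.
    2: by move=> y z [].
  have /negP[] : ~~ ucycleb (@adj T) (x :: q).
    by apply: acT; rewrite /= size_map in sz *.
  by rewrite /ucycleb Up /= rcons_path xq qx.
- case/andP=> /union_pathr[q pq xq]; rewrite {p}pq in sz Up *.
  rewrite last_map /= => qx; rewrite -map_cons map_inj_uniq in Up.
    2: by move=> y z [].
  have /negP[] : ~~ ucycleb (@adj T') (x :: q).
    by apply: acT'; rewrite /= size_map in sz *.
  by rewrite /ucycleb Up /= rcons_path xq qx.
Qed.

Lemma union_connect : (forall u v : T, connect (@adj T) u v) ->
  (forall u v : T', connect (@adj T') u v) ->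
  forall u v : union, in_left u = in_left v -> connect (@adj union) u v.
Proof.
move=> coT coT' [x|x] [y|y] //= _.
- have /connectP[p xp ->] := coT x y; apply/connectP; exists (map inl p).
    by rewrite (path_map (f := inl)).
  by rewrite last_map.
- have /connectP[p xp ->] := coT' x y; apply/connectP; exists (map inr p).
    by rewrite (path_map (f := inr)).
  by rewrite last_map.
Qed.

Lemma card_nbrs_inl x : #|nbrs (inl x : union)| = #|nbrs x|.
Proof.
have inl_inj : injective (@inl T T') by move=> ? ? [].
rewrite -(card_imset (nbrs x) inl_inj); apply: eq_card => -[y|y]; rewrite !inE.
  by rewrite mem_imset // inE.
by apply/esym/imsetP => -[].
Qed.

Lemma card_nbrs_inr x : #|nbrs (inr x : union)| = #|nbrs x|.
Proof.
have inr_inj : injective (@inr T T') by move=> ? ? [].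
rewrite -(card_imset (nbrs x) inr_inj); apply: eq_card => -[y|y]; rewrite !inE.
  by apply/esym/imsetP => -[].
by rewrite mem_imset // inE.
Qed.

End Union.

(** * Functions and sets defined by polynomials *)

Section Definable.
Variables (R : numFieldType) (T T' : sgraph).
Local Notation F := (union T T').
Implicit Types (w : ncpoly R) (f g : F -> R) (S L K : {set F}).

Definition union_kernel w (u v : F) : R :=
  match u, v with
  | inl x, inl y => kernel w x y
  | inr x, inr y => kernel w x y
  | _, _ => 0
  end.

Lemma union_kernelM w1 w2 u v :
  union_kernel (w1 * w2) u v = \sum_x union_kernel w1 u x * union_kernel w2 x v.
Proof.
rewrite big_sumType /=; case: u v => [x|x] [y|y] /=.
- by rewrite kernelM [X in _ + X]big1 ?addr0 // => z _; rewrite mul0r.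
- by rewrite !big1 ?addr0 // => z _; rewrite (mul0r, mulr0).
- by rewrite !big1 ?addr0 // => z _; rewrite (mul0r, mulr0).
- by rewrite kernelM [X in X + _]big1 ?add0r // => z _; rewrite mul0r.
Qed.

Definition definable f :=
  exists w, forall u v, union_kernel w u v = f u *+ (u == v).

Lemma eq_definable f g : f =1 g -> definable f -> definable g.
Proof. by move=> fg [w wf]; exists w => u v; rewrite wf fg. Qed.

Lemma definable_cst a : definable (fun=> a).
Proof.
by exists (a *: 1) => -[x|x] [y|y] //=; rewrite kernelZ kernel1 mulr_natr.
Qed.

Lemma definable_deg : definable (fun u => #|nbrs u|%:R).
Proof.
by exists (ncY R) => -[x|x] [y|y] //=; rewrite kernelY ?card_nbrs_inl ?card_nbrs_inr.
Qed.

Lemma definableD f g : definable f -> definable g -> definable (fun u => f u + g u).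
Proof.
move=> [wf fE] [wg gE]; exists (wf + wg) => u v; rewrite mulrnDl -fE -gE.
by case: u v => [x|x] [y|y] /=; rewrite ?kernelD ?addr0.
Qed.

Lemma definableM f g : definable f -> definable g -> definable (fun u => f u * g u).
Proof.
move=> [wf fE] [wg gE]; exists (wf * wg) => u v; rewrite union_kernelM.
rewrite (bigD1 u) //= big1 => [|x xu]; first by rewrite fE gE eqxx addr0 mulrnAr.
by rewrite fE eq_sym (negbTE xu) mul0r.
Qed.

Lemma definable_prod (I : Type) (r : seq I) (P : pred I) (f : I -> F -> R) :
  (forall i, P i -> definable (f i)) -> definable (fun u => \prod_(i <- r | P i) f i u).
Proof.
move=> def_f; elim: r => [|i r IHr].
  by apply: eq_definable (definable_cst 1) => u; rewrite big_nil.
have [Pi|nPi] := boolP (P i).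
  by apply: eq_definable (definableM (def_f i Pi) IHr) => u; rewrite big_cons Pi.
by apply: eq_definable IHr => u; rewrite big_cons (negbTE nPi).
Qed.

Definition definable_set S := definable (fun u => (u \in S)%:R).

(** Lagrange interpolation at the values of [f]: the product below, over
    the vertices [b] with [f b != a], is 1 where [f] is [a] and 0 elsewhere. *)
Lemma definable_fiber f a : definable f -> definable_set [set u | f u == a].
Proof.
move=> def_f.
have: definable (fun u => \prod_(b | f b != a) ((f u - f b) / (a - f b))).
  apply: definable_prod => b _; apply: definableM (definable_cst _).
  exact: definableD (definable_cst _).
apply: eq_definable => u; rewrite inE; have [->|ua] := eqVneq (f u) a.
  by rewrite big1 // => b ab; rewrite divff // subr_eq0 eq_sym.
by rewrite (bigD1 u) //= subrr mul0r mul0r.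
Qed.

Lemma definable_setC S : definable_set S -> definable_set (~: S).
Proof.
move=> /(@definable_fiber _ 0); congr definable_set; apply/setP=> u.
by rewrite !inE pnatr_eq0 eqb0.
Qed.

Lemma definable_bigcap (P : pred {set F}) :
  (forall S, P S -> definable_set S) -> definable_set (\bigcap_(S | P S) S).
Proof.
move=> /(definable_prod (index_enum _))/eq_definable; apply=> u.
case: (pickP [pred S | P S && (u \notin S)]) => [S /andP[PS uS]|no].
  rewrite (bigD1 S PS) /= (negbTE uS) mul0r.
  by case: bigcapP => // /(_ S PS); rewrite (negbTE uS).
rewrite big1 => [|S PS]; last by have := no S; rewrite /= PS => /negbFE->.
case: bigcapP => // -[] S PS.
by have := no S; rewrite /= PS => /negbFE.
Qed.

Definition color (u : F) : {set {set F}} :=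
  [set S | `[< definable_set S >] && (u \in S)].

Lemma color_definable S : definable_set S -> invariant_set color S.
Proof.
move=> /asboolP def_S u v /setP/(_ S).
by rewrite !inE def_S.
Qed.

(** The colour class of [v] is the intersection [atom v] of the definable sets
    that contain [v], and an invariant set is a union of colour classes. *)
Lemma invariant_definable S : invariant_set color S -> definable_set S.
Proof.
move=> inv_S.
pose atom v := \bigcap_(K in color v) K.
have def_atom v : definable_set (atom v).
  by apply: definable_bigcap => K; rewrite inE => /andP[/asboolP].
have in_atom u v : u \in atom v -> color u = color v.
  move=> /bigcapP uv; apply/setP=> K; apply/idP/idP=> [|vK]; last first.
    by rewrite inE uv // andbT; move: vK; rewrite inE => /andP[].
  rewrite !inE => /andP[def_K uK]; rewrite def_K /=; apply: contraLR uK => vK.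
  rewrite -in_setC; apply: uv; rewrite !inE vK andbT.
  by apply/asboolP/definable_setC/asboolP.
suff -> : S = ~: \bigcap_(K in [set ~: atom v | v in S]) K.
  apply/definable_setC/definable_bigcap => _ /imsetP[v _ ->].
  exact: definable_setC.
apply/setP=> u; rewrite inE; apply/idP/negP=> [uS /bigcapP/(_ (~: atom u))|].
  have -> : ~: atom u \in [set ~: atom v | v in S] by apply/imsetP; exists u.
  rewrite in_setC => /(_ isT)/negP; apply.
  by apply/bigcapP=> K; rewrite inE => /andP[].
move=> no; apply: contraT => uS; case: no; apply/bigcapP=> _ /imsetP[v vS ->].
by rewrite inE; apply: contra uS => /in_atom/inv_S->.
Qed.

Lemma color_fiber f u v : definable f -> color u = color v -> f u = f v.
Proof.
move=> /(definable_fiber (f v))/color_definable inv /inv.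
by rewrite !inE eqxx => /eqP.
Qed.

Lemma color_deg u v : color u = color v -> #|nbrs u| = #|nbrs v|.
Proof. by move/(color_fiber definable_deg)/eqP; rewrite eqr_nat => /eqP. Qed.

Lemma union_kernelX u v : union_kernel (ncX R) u v = (adj u v)%:R.
Proof. by case: u v => [x|x] [y|y] //=; rewrite kernelX. Qed.

(** The kernel of [1_S A 1_L A 1_S] at [x], [y] in [S] counts the common
    neighbours of [x] and [y] in [L].  There are none for [x <> y], since a
    vertex of [L] has at most one neighbour in [S]; so this product is a
    diagonal matrix, and its diagonal is constant on colours. *)
Lemma color_nbrs S L : invariant_set color S -> invariant_set color L ->
  (forall x, x \in L -> #|nbrs x :&: S| <= 1)%N ->
  forall u v, u \in S -> v \in S -> color u = color v ->
  #|nbrs u :&: L| = #|nbrs v :&: L|.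
Proof.
move=> /invariant_definable[wS wSE] /invariant_definable[wL wLE] L1 u v uS vS cuv.
have mul_diag w w' (g : F -> R) x y :
    (forall x y, union_kernel w' x y = g x *+ (x == y)) ->
    union_kernel (w * w') x y = union_kernel w x y * g y.
  move=> w'E; rewrite union_kernelM (bigD1 y) //= w'E eqxx big1 ?addr0 // => z zy.
  by rewrite w'E (negbTE zy) mulr0.
suff: definable (fun x => (x \in S)%:R * #|nbrs x :&: L|%:R).
  by move/color_fiber/(_ cuv)/eqP; rewrite uS vS !mul1r eqr_nat => /eqP.
exists (wS * (ncX R * wL * ncX R) * wS) => x y.
rewrite (mul_diag _ _ _ _ _ wSE) union_kernelM (bigD1 x) //= big1 => [|z zx]; last first.
  by rewrite wSE eq_sym (negbTE zx) mul0r.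
rewrite wSE eqxx addr0 union_kernelM.
have [xS|] := boolP (x \in S); last by rewrite mulr0n !mul0r mul0rn.
have [yS|yS] := boolP (y \in S); last first.
  by rewrite mulr0 (_ : x == y = false) //; apply: contraNF yS => /eqP<-.
rewrite mul1r mulr1 mul1r -sumr_const.
have [<-|xy] := eqVneq x y.
  rewrite mulr1n [RHS]big_mkcond; apply: eq_bigr => z _.
  rewrite (mul_diag _ _ _ _ _ wLE) !union_kernelX !inE [adj z x]adj_sym.
  by case: (adj x z); case: (z \in L); rewrite /= ?mulr0 ?mul0r ?mulr1.
rewrite mulr0n big1 // => z _; rewrite (mul_diag _ _ _ _ _ wLE) !union_kernelX.
apply/eqP; rewrite !mulf_eq0 !pnatr_eq0 !eqb0; apply: contraT.
rewrite !negb_or !negbK => /andP[/andP[xz zL] zy].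
case/negP: xy; apply/eqP; have /card_le1_eqP := L1 z zL; apply.
  by rewrite in_setI in_nbrs zy.
by rewrite in_setI in_nbrs adj_sym xz.
Qed.

Lemma union_moment w : moment T w = moment T' w ->
  \sum_(u | in_left u) \sum_v union_kernel w u v =
  \sum_(u : F | ~~ in_left u) \sum_v union_kernel w u v.
Proof.
rewrite !moment_kernel => eq_w; rewrite [LHS]big_sumType [RHS]big_sumType /=.
rewrite !big_pred0_eq addr0 add0r.
under eq_bigr do rewrite big_sumType /= [X in _ + X]big1 // addr0.
by under [RHS]eq_bigr do rewrite big_sumType /= [X in X + _]big1 // add0r.
Qed.

(** The moment of a polynomial defining a colour class is the number of vertices
    of that class in the tree. *)
Lemma color_side : (forall w, moment T w = moment T' w) -> forall k,
  #|[set x in [set x | in_left x] | color x == k]| =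
  #|[set x in [set x | ~~ in_left x] | color x == k]|.
Proof.
move=> eq_w k.
have [w wE] : definable_set [set x | color x == k].
  by apply: invariant_definable => u v cuv; rewrite !inE cuv.
have count (P : pred F) : \sum_(u | P u) \sum_v union_kernel w u v =
    #|[set x in [set x | P x] | color x == k]|%:R.
  rewrite -sumr_const big_mkcond [RHS]big_mkcond; apply: eq_bigr => u _.
  rewrite !inE; case: (P u) => //=; rewrite (bigD1 u) //= big1 => [|v vu].
    by rewrite wE eqxx inE addr0; case: eqP.
  by rewrite wE eq_sym (negbTE vu).
by apply/eqP; rewrite -(eqr_nat R) -!count union_moment.
Qed.

End Definable.

(** * Reconstruction of a tree from its moments *)

Theorem theorem5p4 (R : realType) (T T' : sgraph) (hT : is_tree T)
  (hT' : is_tree T')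
  (hmu : forall w : ncpoly R, moment T w = moment T' w) : graph_iso T T'.
Proof.
case: hT hT' => [[_ coT] acT] [[_ coT'] acT'].
have [f [f_side f_inj f_adj]] := coloured_forest_matching
  (union_acyclic acT acT') (@union_adj_side T T') (union_connect coT coT')
  (@color_deg R T T') (@color_nbrs R T T') (color_side hmu).
have f_right x : {y | f (inl x) = inr y}.
  by have := f_side (inl x) isT; case: (f (inl x)) => // y _; exists y.
exists (fun x => sval (f_right x)); last first.
  move=> u v; case: (f_right u) (f_right v) => [y fu] [z fv] /=.
  by have := f_adj (inl u) (inl v) isT isT; rewrite fu fv.
apply: inj_card_bij => [u v|].
  case: (f_right u) (f_right v) => [y fu] [z fv] /= yz.
  by have [] : inl u = inl v :> union T T' by apply: f_inj; rewrite // fu fv yz.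
by have /eqP := hmu 1; rewrite !moment1 eqr_nat => /eqP->.
Qed.
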